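(* Let $X$ and $Y$ be infinite Tychonoff spaces. Assume that $Y$ is compact. Then $C_p(X,C(Y))$ contains a complemented copy of $\mathbb{R}^\omega$ or a complemented copy of $(c_0)_p$.
   Context: $C(Y)$ is the Banach space of continuous real-valued functions on the compact space $Y$ with the supremum norm. For a locally convex space $E$, $C_p(X,E)$ is the space of all continuous functions $X\to E$ with the pointwise topology (inherited from the product $E^X$). Tychonoff means completely regular and Hausdorff. $\mathbb{R}^\omega$ carries the product topology, and $(c_0)_p=\{x\in\mathbb{R}^\omega: x(n)\to 0\}$ with the topology inherited from $\mathbb{R}^\omega$. A locally convex space $G$ contains a complemented copy of $F$ if there are closed linear subspaces $G_1,G_2$ of $G$ with $G=G_1\oplus G_2$ algebraically, $G_1$ linearly homeomorphic to $F$, and the natural projection of $G$ onto $G_1$ continuous. *)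

(* Defs.v *)
From HB Require Import structures.
From mathcomp Require Import all_boot all_order all_algebra.
From mathcomp Require Import all_classical all_reals all_analysis.
From mathcomp Require Import ring lra.
Set Implicit Arguments.
Unset Strict Implicit.
Unset Printing Implicit Defensive.
Import Order.TTheory GRing.Theory Num.Theory.
Import numFieldNormedType.Exports.
Local Open Scope classical_set_scope.
Local Open Scope ring_scope.

Section convex_preimage.
Local Open Scope convex_scope.
Context {K : numFieldType} {V W : lmodType K}.

Lemma convex_set_preimage (f : {linear V -> W}) (A : set W) :
  convex_set A -> convex_set (f @^-1` A).
Proof.
move=> cA x y l /set_mem xA /set_mem yA; apply/mem_set => /=.
have -> : f (x <| l |> y) =
   ((f x : convex_lmodType W) <| l |> (f y : convex_lmodType W)).
  by rewrite linearD !linearZ.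
by apply/set_mem/cA; exact: mem_set.
Qed.

Lemma convex_setI (A B : set V) :
  convex_set A -> convex_set B -> convex_set (A `&` B).
Proof.
move=> cA cB x y l /set_mem[xA xB] /set_mem[yA yB]; apply/mem_set; split.
  by apply/set_mem/cA; exact: mem_set.
by apply/set_mem/cB; exact: mem_set.
Qed.

Lemma convex_setT : convex_set [set: V].
Proof. by move=> x y l _ _; exact: mem_set. Qed.

End convex_preimage.

Section power.
Context {K : numFieldType}.

(* The product E^I as a locally convex space. *)
Definition power (I : Type) (E : tvsType K) : Type := {ptws I -> E}.

Context {I : Type} {E : tvsType K}.

HB.instance Definition _ := GRing.Lmodule.copy (power I E) (I -> E).
HB.instance Definition _ := Topological.copy (power I E) {ptws I -> E}.

Lemma cvg_power (F : set_system (power I E)) (f : power I E) : Filter F ->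
  F --> f <-> forall i, (fun g : power I E => g i) @ F --> f i.
Proof.
move=> FF; split => [Ff i A fA|H].
  move/cvg_sup : Ff => /(_ i) /=; apply.
  exact: (@initial_continuous (forall i : I, E) E (fun g => g i)).
apply/cvg_sup => i A [_ [[B oB <-]] Bfi BA].
apply: (filterS BA); apply: (H i); exact: open_nbhs_nbhs.
Qed.

Lemma power_proj_continuous (i : I) : continuous (fun g : power I E => g i).
Proof. by move=> f; apply: ((cvg_power f (nbhs_filter f)).1 _ i). Qed.

Lemma power_add_continuous :
  continuous (fun x : power I E * power I E => x.1 + x.2).
Proof.
move=> x; apply: (cvg_power _ (fmap_filter _ (nbhs_filter x))).2 => i.
apply: (@continuous2_cvg _ _ _ _ _ _ _ _ (fun a b : E => a + b) _ _
  (@add_continuous E (x.1 i, x.2 i))).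
- apply: (@continuous_comp _ _ _ fst (fun g : power I E => g i)).
    exact: cvg_fst.
  exact: power_proj_continuous.
- apply: (@continuous_comp _ _ _ snd (fun g : power I E => g i)).
    exact: cvg_snd.
  exact: power_proj_continuous.
Qed.

Lemma power_scale_continuous :
  continuous (fun z : K^o * power I E => z.1 *: z.2).
Proof.
move=> x; apply: (cvg_power _ (fmap_filter _ (nbhs_filter x))).2 => i.
apply: (@continuous2_cvg _ _ _ _ _ _ _ _ (fun (a : K^o) (b : E) => a *: b) _ _
  (@scale_continuous K E (x.1, x.2 i))).
- exact: cvg_fst.
- apply: (@continuous_comp _ _ _ snd (fun g : power I E => g i)).
    exact: cvg_snd.
  exact: power_proj_continuous.
Qed.

Let proj_lin (i : I) (g : power I E) : E := g i.

Let proj_linP i : linear (proj_lin i).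
Proof. by move=> a u v. Qed.

HB.instance Definition _ i :=
  GRing.isLinear.Build K (power I E) E *:%R (proj_lin i) (proj_linP i).

Lemma power_locally_convex : exists2 B : set_system (power I E),
  (forall b, b \in B -> convex_set b) & basis B.
Proof.
exists [set b | open b /\ convex_set b]; first by move=> b /set_mem[].
split=> [b []//|f].
have FF : Filter (filter_from [set U : set (power I E) |
    (open U /\ convex_set U) /\ U f] id).
  apply: filter_from_filter.
    by exists setT; split => //; split; [exact: openT|exact: convex_setT].
  move=> A B [[oA cA] fA] [[oB cB] fB]; exists (A `&` B) => //.
  by split => //; split; [exact: openI|exact: convex_setI].
apply: (cvg_power _ FF).2 => i A fiA.
have [B cB [oB]] := @locally_convex K E.
move=> /(_ (f i) A fiA)[b [Bb bfi] bA].
exists (proj_lin i @^-1` b); last by move=> g; exact: bA.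
split => //; split; last by apply/convex_set_preimage/cB/mem_set.
by move/continuousP: (@power_proj_continuous i); apply; exact: oB.
Qed.

(* In the library version at hand the factory [PreTopologicalLmod_isTvs] only
   produces the uniformity; the remaining mixins have to be given separately. *)
HB.instance Definition _ := PreTopologicalLmod_isTvs.Build K (power I E)
  power_add_continuous power_scale_continuous power_locally_convex.
HB.instance Definition _ := PreTopologicalNmodule_isTopologicalNmodule.Build
  (power I E) power_add_continuous.
HB.instance Definition _ := TopologicalNmodule_isTopologicalLmodule.Build
  K (power I E) power_scale_continuous.
HB.instance Definition _ := Uniform_isTvs.Build
  K (power I E) power_locally_convex.

End power.

Section initial_tvs.
Context {K : numFieldType} {V : lmodType K} {E : tvsType K}.
Variable f : {linear V -> E}.
Let W := initial_topology f.

HB.instance Definition _ := GRing.Lmodule.copy W V.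

Lemma initial_add_continuous : continuous (fun x : W * W => x.1 + x.2).
Proof.
apply: continuous_comp_initial => x.
have -> : f \o (fun x : W * W => x.1 + x.2) = (fun x => f x.1 + f x.2).
  by apply/funext => z /=; rewrite linearD.
apply: (@continuous2_cvg _ _ _ _ _ _ _ _ (fun a b : E => a + b) _ _
  (@add_continuous E (f x.1, f x.2))).
- apply: (@continuous_comp _ W _ fst f); first exact: cvg_fst.
  exact: initial_continuous.
- apply: (@continuous_comp _ W _ snd f); first exact: cvg_snd.
  exact: initial_continuous.
Qed.

Lemma initial_scale_continuous : continuous (fun z : K^o * W => z.1 *: z.2).
Proof.
apply: continuous_comp_initial => x.
have -> : f \o (fun z : K^o * W => z.1 *: z.2) = (fun x => x.1 *: f x.2).
  by apply/funext => z /=; rewrite linearZ.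
apply: (@continuous2_cvg _ _ _ _ _ _ _ _ (fun (a : K^o) (b : E) => a *: b) _ _
  (@scale_continuous K E (x.1, f x.2))).
- exact: cvg_fst.
- apply: (@continuous_comp _ W _ snd f); first exact: cvg_snd.
  exact: initial_continuous.
Qed.

Lemma initial_locally_convex : exists2 B : set_system W,
  (forall b, b \in B -> convex_set b) & basis B.
Proof.
have [B cB [oB Bb]] := @locally_convex K E.
exists [set f @^-1` b | b in B].
  by move=> _ /set_mem[b bB <-]; apply/convex_set_preimage/cB/mem_set.
split=> [_ [b bB <-]|x U].
  by exists b => //; exact: oB.
case=> _ [[A oA <-] Afx AU].
have [|b [Bb' bfx] bA] := Bb (f x) A; first exact: open_nbhs_nbhs.
exists (f @^-1` b); first by split => //; exists b.
by move=> y /= /bA; exact: AU.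
Qed.

End initial_tvs.

Section continuous_lmodule.
Context {X : topologicalType} {K : numFieldType} {E : tvsType K}.
Notation C := (continuousType X E).

Lemma cont_add (f g : C) : continuous (fun x => f x + g x).
Proof.
move=> x; apply: (@continuous2_cvg _ _ _ _ _ _ _ _ (fun a b : E => a + b) _ _
  (@add_continuous E (f x, g x))); exact: cts_fun.
Qed.

Lemma cont_scale (k : K) (f : C) : continuous (fun x => k *: f x).
Proof.
move=> x; apply: (@continuous2_cvg _ _ _ _ _ _ _ _
  (fun (a : K^o) (b : E) => a *: b) _ _
  (@scale_continuous K E (k, f x))).
  exact: cvg_cst.
exact: cts_fun.
Qed.

Lemma cont_opp (f : C) : continuous (fun x => - f x).
Proof.
move=> x; apply: (@continuous_comp _ _ _ f -%R); first exact: cts_fun.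
exact: opp_continuous.
Qed.

Let zero : C := cst 0.
Let add (f g : C) : C := mkcts (@cont_add f g).
Let scale (k : K) (f : C) : C := mkcts (@cont_scale k f).
Let opp (f : C) : C := mkcts (@cont_opp f).

Let addA : associative add.
Proof. by move=> f g h; apply/continuousEP => x; exact: addrA. Qed.
Let addC : commutative add.
Proof. by move=> f g; apply/continuousEP => x; exact: addrC. Qed.
Let add0 : left_id zero add.
Proof. by move=> f; apply/continuousEP => x; exact: add0r. Qed.
Let addN : left_inverse zero opp add.
Proof. by move=> f; apply/continuousEP => x; exact: addNr. Qed.

HB.instance Definition _ := GRing.isZmodule.Build C addA addC add0 addN.

Let scaleA a b (v : C) : scale a (scale b v) = scale (a * b) v.
Proof. by apply/continuousEP => x; exact: scalerA. Qed.
Let scale1 : left_id 1 scale.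
Proof. by move=> f; apply/continuousEP => x; exact: scale1r. Qed.
Let scaleDr : right_distributive scale +%R.
Proof. by move=> a f g; apply/continuousEP => x; exact: scalerDr. Qed.
Let scaleDl (v : C) : {morph scale^~ v : a b / a + b}.
Proof. by move=> a b; apply/continuousEP => x; exact: scalerDl. Qed.

HB.instance Definition _ :=
  GRing.Zmodule_isLmodule.Build K C scaleA scale1 scaleDr scaleDl.

Lemma continuousDE (f g : C) x : (f + g) x = f x + g x. Proof. by []. Qed.
Lemma continuousZE k (f : C) x : (k *: f) x = k *: f x. Proof. by []. Qed.

End continuous_lmodule.

Section Cp.
Context {K : numFieldType}.

(* C_p(X,E), with the topology induced by [Cp_val : Cp X E -> E^X]. *)
Definition Cp (X : topologicalType) (E : tvsType K) : Type :=
  continuousType X E.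

Context {X : topologicalType} {E : tvsType K}.

HB.instance Definition _ := GRing.Lmodule.copy (Cp X E) (continuousType X E).

Definition Cp_val (f : Cp X E) : power X E := f : continuousType X E.

Let Cp_val_linear : linear Cp_val. Proof. by []. Qed.
HB.instance Definition _ := GRing.isLinear.Build K (Cp X E) (power X E) *:%R
  Cp_val Cp_val_linear.

HB.instance Definition _ := Topological.copy (Cp X E) (initial_topology Cp_val).
HB.instance Definition _ := PreTopologicalLmod_isTvs.Build K (Cp X E)
  (@initial_add_continuous K (Cp X E) (power X E) Cp_val)
  (@initial_scale_continuous K (Cp X E) (power X E) Cp_val)
  (@initial_locally_convex K (Cp X E) (power X E) Cp_val).
HB.instance Definition _ := PreTopologicalNmodule_isTopologicalNmodule.Build
  (Cp X E) (@initial_add_continuous K (Cp X E) (power X E) Cp_val).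
HB.instance Definition _ := TopologicalNmodule_isTopologicalLmodule.Build
  K (Cp X E) (@initial_scale_continuous K (Cp X E) (power X E) Cp_val).
HB.instance Definition _ := Uniform_isTvs.Build
  K (Cp X E) (@initial_locally_convex K (Cp X E) (power X E) Cp_val).

End Cp.

Section sup_norm.
Context {R : realType} {Y : topologicalType}.

(* [sup] of the empty set is 0, so the norm is also correct when Y is empty. *)
Definition sup_norm (f : continuousType Y R) : R :=
  sup (range (fun y => `|f y|)).

(* The compactness proof is a parameter of the type: it is what makes
   [sup_norm] a norm. *)
Definition Csup of compact [set: Y] : Type := continuousType Y R.

Variable cY : compact [set: Y].

HB.instance Definition _ := GRing.Lmodule.copy (Csup cY) (continuousType Y R).

Let norm (f : Csup cY) : R := sup_norm f.

Lemma sup_norm_bounded (f : continuousType Y R) :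
  has_ubound (range (fun y => `|f y|)).
Proof.
have cf : {within [set: Y], continuous f}.
  by apply: continuous_subspaceT => x; exact: cts_fun.
have /compact_bounded[M [_ Mf]] := continuous_compact cf cY.
exists (M + 1) => _ [y _ <-]; apply: Mf; first by rewrite ltrDl.
by exists y.
Qed.

Lemma le_sup_norm (f : continuousType Y R) y : `|f y| <= sup_norm f.
Proof. by apply: ub_le_sup; [exact: sup_norm_bounded|exists y]. Qed.

Lemma sup_norm_ge0 (f : continuousType Y R) : 0 <= sup_norm f.
Proof.
have [[y _]|/set0P/negP/negPn/eqP Y0] := pselect ([set: Y] !=set0).
  by apply: le_trans (le_sup_norm f y).
by rewrite /sup_norm Y0 image_set0 sup0.
Qed.

Lemma sup_norm_le (f : continuousType Y R) (M : R) : 0 <= M ->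
  (forall y, `|f y| <= M) -> sup_norm f <= M.
Proof.
move=> M0 fM; have [[y _]|/set0P/negP/negPn/eqP Y0] := pselect ([set: Y] !=set0).
  apply: ge_sup; first by exists `|f y|; exists y.
  by move=> _ [z _ <-].
by rewrite /sup_norm Y0 image_set0 sup0.
Qed.

Let norm_leD (f g : Csup cY) : norm (f + g) <= norm f + norm g.
Proof.
apply: sup_norm_le => [|y]; first by rewrite addr_ge0// sup_norm_ge0.
by rewrite (le_trans (ler_normD _ _))// lerD// le_sup_norm.
Qed.

Let normZ (k : R) (f : Csup cY) : norm (k *: f) = `|k| * norm f.
Proof.
have le_normZ l (g : Csup cY) : norm (l *: g) <= `|l| * norm g.
  apply: sup_norm_le => [|y]; first by rewrite mulr_ge0// sup_norm_ge0.
  by rewrite continuousZE normrM ler_wpM2l// le_sup_norm.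
apply/eqP; rewrite eq_le le_normZ /=.
have [->|k0] := eqVneq k 0; first by rewrite normr0 mul0r sup_norm_ge0.
rewrite -ler_pdivlMl ?normr_gt0// -normfV.
by rewrite -{1}[f]scale1r -(mulVf k0) -scalerA.
Qed.

Let norm0_eq0 (f : Csup cY) : norm f = 0 -> f = 0.
Proof.
move=> f0; apply/continuousEP => y; apply/eqP.
by rewrite -normr_le0 -f0 le_sup_norm.
Qed.

HB.instance Definition _ :=
  Lmodule_isNormed.Build R (Csup cY) norm_leD normZ norm0_eq0.

Lemma norm_CsupE (f : Csup cY) : `|f| = sup_norm f. Proof. by []. Qed.

Lemma Csup_cauchy_cvg (F : set_system (Csup cY)) :
  ProperFilter F -> cauchy F -> cvg F.
Proof.
move=> FF Fc.
have Fball e : 0 < e -> exists f : Csup cY, F (ball f e).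
  move=> e0; by have /cauchyP := Fc; exact.
pose ev y (f : Csup cY) : R := (f : continuousType Y R) y.
have ev_le y (f g : Csup cY) : `|ev y f - ev y g| <= `|f - g|.
  exact: (le_sup_norm (f - g : Csup cY) y).
have evc y : cvg (ev y @ F).
  apply: cauchy_cvg; apply/cauchyP => e e0.
  have [f Ff] := Fball _ e0; exists (ev y f).
  change (F (ev y @^-1` ball (ev y f) e)).
  apply: filterS Ff => h; rewrite -ball_normE/= => fh.
  exact: le_lt_trans (ev_le y f h) fh.
pose g y : R := lim (ev y @ F).
have near_g (f : Csup cY) e : F (ball f e) -> forall y, `|ev y f - g y| <= e.
  move=> Ff y; rewrite distrC.
  have cl : closed (closed_ball_ Num.norm (ev y f) e) by exact: closed_closed_ball_.
  have : closed_ball_ Num.norm (ev y f) e (g y).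
    apply: (closed_cvg _ cl _ _ (evc y)) => //.
    apply: filterS Ff => h; rewrite -ball_normE/= => fh.
    exact: ltW (le_lt_trans (ev_le y f h) fh).
  by rewrite /closed_ball_/= distrC.
have gc : continuous g.
  move=> y; apply/cvgrPdist_le => e e0.
  have [f Ff] := Fball (e / 3) (divr_gt0 e0 (ltr0Sn _ _)).
  have : (f : continuousType Y R) z @[z --> y] --> ev y f by exact: cts_fun.
  move=> /cvgrPdist_le/(_ (e / 3) (divr_gt0 e0 (ltr0Sn _ _))).
  apply: filterS => z fyz.
  have -> : g y - g z = (g y - ev y f) + (ev y f - ev z f) + (ev z f - g z).
    by ring.
  have -> : e = e / 3 + e / 3 + e / 3 by lra.
  apply: (le_trans (ler_normD _ _)); apply: lerD; last exact: near_g.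
  apply: (le_trans (ler_normD _ _)); apply: lerD => //.
  by rewrite distrC; exact: near_g.
pose G : Csup cY := (mkcts gc : continuousType Y R).
apply/cvg_ex; exists G.
apply/cvgrPdist_le => e e0.
have e20 : 0 < e / 2 by rewrite divr_gt0.
have [f Ff] := Fball _ e20.
apply: filterS (Ff) => h; rewrite -ball_normE/= => fh.
apply: sup_norm_le => [|y]; first exact: ltW.
rewrite (_ : (_ : continuousType Y R) y = (g y - ev y f) + (ev y f - ev y h));
  last by rewrite addrA subrK.
have -> : e = e / 2 + e / 2 by lra.
apply: (le_trans (ler_normD _ _)); apply: lerD.
  by rewrite distrC; exact: near_g.
exact: le_trans (ev_le y f h) (ltW fh).
Qed.

HB.instance Definition _ := Uniform_isComplete.Build (Csup cY) Csup_cauchy_cvg.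

End sup_norm.
Arguments Csup R {Y} cY.

Section sequence_spaces.
Context (R : realType).

Definition Romega : Type := power nat R.

HB.instance Definition _ := Tvs.on Romega.

Definition c0 : {pred Romega} := fun x => `[< x n @[n --> \oo] --> (0 : R) >].

Let c0_submod : submod_closed c0.
Proof.
split=> [|a x y]; first by apply/asboolP; exact: cvg_cst.
rewrite !unfold_in => /asboolP x0 /asboolP y0; apply/asboolP.
have -> : (0 : R) = a * 0 + 0 by rewrite mulr0 addr0.
by apply: cvgD y0; apply: cvgMr x0.
Qed.

HB.instance Definition _ := GRing.isSubmodClosed.Build R Romega c0 c0_submod.

Record c0p := C0p { c0p_val : Romega; _ : c0p_val \in c0 }.

HB.instance Definition _ := [isSub for c0p_val].
HB.instance Definition _ := [Choice of c0p by <:].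
HB.instance Definition _ := [SubChoice_isSubLmodule of c0p by <:].

HB.instance Definition _ := Topological.copy c0p (initial_topology c0p_val).
HB.instance Definition _ := PreTopologicalLmod_isTvs.Build R c0p
  (@initial_add_continuous R c0p Romega \val)
  (@initial_scale_continuous R c0p Romega \val)
  (@initial_locally_convex R c0p Romega \val).
HB.instance Definition _ := PreTopologicalNmodule_isTopologicalNmodule.Build
  c0p (@initial_add_continuous R c0p Romega \val).
HB.instance Definition _ := TopologicalNmodule_isTopologicalLmodule.Build
  R c0p (@initial_scale_continuous R c0p Romega \val).
HB.instance Definition _ := Uniform_isTvs.Build
  R c0p (@initial_locally_convex R c0p Romega \val).

End sequence_spaces.

Section complemented_copy.
Context {K : numFieldType}.

Definition direct_sum_decomposition (G : lmodType K) (G1 G2 : set G) :=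
  forall x, exists! p : G * G, [/\ G1 p.1, G2 p.2 & p.1 + p.2 = x].

(* Given [direct_sum_decomposition G1 G2], such a P exists and is unique: it is
   the natural projection onto G1. *)
Definition projection_along (G : lmodType K) (G1 G2 : set G) (P : G -> G) :=
  forall x, G1 (P x) /\ G2 (x - P x).

(* S is defined on all of G, but only its restriction to G1 (with the subspace
   topology) matters: there it is the inverse of T. *)
Definition linearly_homeomorphic_to (G F : tvsType K) (G1 : set G) :=
  exists (T : {linear F -> G}) (S : G -> F),
    [/\ range T = G1, cancel T S, continuous T & {within G1, continuous S}].

Definition contains_complemented_copy (G F : tvsType K) :=
  exists G1 G2 : set G,
    [/\ closed G1 /\ submod_closed [in G1], closed G2 /\ submod_closed [in G2],
        direct_sum_decomposition G1 G2, linearly_homeomorphic_to F G1 &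
        exists P : G -> G, projection_along G1 G2 P /\ continuous P].

End complemented_copy.

(* The library states complete regularity with uniformities; [uniform_separatorP]
   gives the formulation with a continuous function into [0, 1]. *)
Definition tychonoff_space (T : topologicalType) :=
  completely_regular_space T /\ hausdorff_space T.

(* Main.v *)
Require Import Defs.
From HB Require Import structures.
From mathcomp Require Import all_boot all_order all_algebra.
From mathcomp Require Import all_classical all_reals all_analysis.
From mathcomp Require Import ring lra.
Set Implicit Arguments.
Unset Strict Implicit.
Unset Printing Implicit Defensive.
Import Order.TTheory GRing.Theory Num.Theory.
Import numFieldNormedType.Exports.
Local Open Scope classical_set_scope.
Local Open Scope ring_scope.

(** A complemented copy of F in G is the same thing as a pair of continuous
    linear maps T : F -> G and S : G -> F with S T = id: then T S projects G
    onto the range of T along the kernel of S ([complemented_copy_retract]).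
    Both alternatives are obtained from such a pair, with E = C(Y).

    In both cases T spreads a sequence a over X: for functions phi_i on X with
    pairwise disjoint cozero sets and vectors u_i of E,
      (T a)(x) = sum_i a_(N i) phi_i(x) u_i,
    a sum with at most one nonzero term at each x. Hence T is continuous for the
    pointwise topology, whatever the phi_i, and the only issue is whether T a is
    a continuous function of x ([complemented_copy_glue]).

    Suppose that some continuous f : X -> E has a range that is not totally
    bounded. Then there are points p_n with |f p_n - f p_m| >= e for n <> m, and
    the functions x |-> max(0, 1 - (4/e) |f x - f p_n|) form a locally finite
    family. So T a is continuous for every sequence a, and evaluation at the p_n
    followed by a functional l with l u = 1 is a left inverse of T: this gives a
    copy of R^omega ([Romega_complemented]).

    Otherwise every continuous f : X -> E has a totally bounded range. Choose
    bumps psi_i on Y with disjoint cozero sets and psi_i(y_i) = 1, and bumps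
    phi_s on X with disjoint cozero sets and phi_s(x_s) = 1, indexed by the
    finite sequences of signs s. The functionals
      mu_m(f) = 1/(m 2^m) sum_(s in {-1,1}^m) sum_(i < m) s_i f(x_s)(y_i)
    form an explicit Josefson-Nissenzweig sequence. If f is constant, with value
    g, then by orthogonality of the coordinates s_i the mean over s of
    |sum_i s_i g(y_i)| / m is at most |g| / sqrt m, even though the absolute
    values forbid any cancellation between different s. Because of these absolute
    values the estimate is also uniform over all choices of g in a finite set
    depending on s, and a finite net of the range of f gives mu_m(f) -> 0
    ([sign_mean_cvg0]). So S f = (mu_m(f))_m lies in c_0, and it is a left
    inverse of T for u_s = sum_i s_i psi_i, which has norm at most 1; T a is
    continuous because only finitely many of its terms exceed any given e
    ([c0p_complemented]).

    The bumps exist because an infinite space whose points are separated by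
    continuous functions has infinitely many disjoint nonempty cozero sets
    ([disjoint_bumps]). *)

(** * Complemented copies as retracts *)

Lemma closed_fixpoints (T : topologicalType) (f : T -> T) :
  hausdorff_space T -> continuous f -> closed [set x | f x = x].
Proof.
move=> hT cf x clx; apply: hT => A B Ax Bx.
have fA : nbhs x (f @^-1` A) := cf x A Ax.
by have [y [/= fy [Ay By]]] := clx _ (filterI fA Bx); exists y; rewrite fy in Ay.
Qed.

(** The two summands are the range of T, which is the set of fixed points of
    T S, and the kernel of S; both are closed because T S is continuous and G is
    Hausdorff. *)
Lemma complemented_copy_retract (K : numFieldType) (G F : tvsType K)
    (T : F -> G) (S : G -> F) :
  hausdorff_space G -> linear T -> linear S -> continuous T -> continuous S ->
  cancel T S -> contains_complemented_copy G F.
Proof.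
move=> hG lT lS.
pose mT := GRing.isLinear.Build K F G *:%R T lT.
pose mS := GRing.isLinear.Build K G F *:%R S lS.
pose T' : {linear F -> G} := HB.pack T mT.
pose S' : {linear G -> F} := HB.pack S mS.
rewrite -[T]/(T' : F -> G) -[S]/(S' : G -> F).
move: T' S' => {lT lS mT mS}{}T {}S cT cS TK.
have cTS : continuous (T \o S).
  by move=> x; apply: continuous_comp; [exact: cS|exact: cT].
exists [set x | T (S x) = x], [set x | S x = 0]; split.
- split; first exact: (closed_fixpoints hG cTS).
  split=> [|a u v]; rewrite !inE /= ?linear0 // => uE vE.
  by rewrite !linearP uE vE.
- split.
    have -> : [set x | S x = 0] = (T \o S) @^-1` [set 0].
      apply/seteqP; split=> x /= [xE]; first by rewrite xE linear0.
      by rewrite -[S x]TK xE linear0.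
    move/continuous_closedP: cTS; apply.
    exact/accessible_closed_set1/hausdorff_accessible.
  split=> [|a u v]; rewrite !inE /= ?linear0 // => uE vE.
  by rewrite linearP uE vE scaler0 addr0.
- move=> x; exists (T (S x), x - T (S x)); split.
    by split=> /=; rewrite ?TK // ?linearB /= ?TK ?subrr // subrKC.
  move=> [u v] [/= uE vE <-].
  by rewrite linearD /= vE addr0 uE addrAC subrr add0r.
- exists T, S; split=> //; last exact: continuous_subspaceT.
  by apply/seteqP; split=> [_ [x _ <-]|x /= xE]; [rewrite /= TK|exists (S x)].
- exists (T \o S); split=> // x; split=> /=; first by rewrite TK.
  by rewrite linearB /= TK subrr.
Qed.

(** * The topologies of C_p(X,E), R^omega, (c_0)_p and C(Y) *)

Lemma Cp_eval_continuous (K : numFieldType) (X : topologicalType)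
    (E : tvsType K) (x : X) :
  continuous (fun f : Cp X E => (f : continuousType X E) x).
Proof.
move=> f; apply: (@continuous_comp _ _ _ (@Cp_val K X E)
  (fun g : power X E => g x)).
  exact: initial_continuous.
exact: power_proj_continuous.
Qed.

Lemma Cp_hausdorff (K : numFieldType) (X : topologicalType) (E : tvsType K) :
  hausdorff_space E -> hausdorff_space (Cp X E).
Proof.
move=> hE f g fg; apply/continuousEP => x; apply: hE => A B.
move=> /Cp_eval_continuous fA /Cp_eval_continuous gB.
by have [h [Ah Bh]] := fg _ _ fA gB; exists ((h : continuousType X E) x).
Qed.

Lemma continuous_to_Cp (K : numFieldType) (Z X : topologicalType)
    (E : tvsType K) (T : Z -> Cp X E) :
  (forall x, continuous (fun z => (T z : continuousType X E) x)) ->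
  continuous T.
Proof.
move=> cT; apply: (@continuous_comp_initial _ _ _ (@Cp_val K X E)) => z.
by apply/(cvg_power _ (fmap_filter _ (nbhs_filter z))) => x; exact: cT.
Qed.

Lemma continuous_to_Romega (R : realType) (Z : topologicalType)
    (S : Z -> Romega R) :
  (forall n, continuous (fun z => (S z : nat -> R) n)) -> continuous S.
Proof.
move=> cS z.
by apply/(cvg_power _ (fmap_filter _ (nbhs_filter z))) => n; exact: cS.
Qed.

Lemma continuous_to_c0p (R : realType) (Z : topologicalType) (S : Z -> c0p R) :
  (forall n, continuous (fun z => (c0p_val (S z) : nat -> R) n)) ->
  continuous S.
Proof.
move=> cS; apply: (@continuous_comp_initial _ _ _ (@c0p_val R)).
exact: continuous_to_Romega.
Qed.

Lemma Romega_coord_continuous (R : realType) (n : nat) :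
  continuous (fun a : Romega R => (a : nat -> R) n).
Proof. exact: power_proj_continuous. Qed.

Lemma c0p_coord_continuous (R : realType) (n : nat) :
  continuous (fun a : c0p R => (c0p_val a : nat -> R) n).
Proof.
move=> a; apply: (@continuous_comp _ _ _ (@c0p_val R)
  (fun b : Romega R => (b : nat -> R) n)).
  exact: initial_continuous.
exact: Romega_coord_continuous.
Qed.

Lemma Csup_eval_continuous (R : realType) (Y : topologicalType)
    (cY : compact [set: Y]) (y : Y) :
  continuous (fun g : Csup R cY => (g : continuousType Y R) y).
Proof.
move=> g; apply/(cvgrPdist_le (FF := nbhs_filter g)) => e e0.
apply: (@filterS _ _ (nbhs_filter g) (ball g e)); last exact: nbhsx_ballx.
move=> h gh; have : `|g - h| < e by rewrite -ball_normE in gh.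
by move/ltW; apply: le_trans; exact: (le_sup_norm cY (g - h : Csup R cY) y).
Qed.
(** * Bumps with disjoint cozero sets *)

Lemma tychonoff_separates (R : realType) (T : topologicalType) (a b : T) :
  tychonoff_space T -> a <> b ->
  exists f : T -> R, [/\ continuous f, f a = 0 & f b = 1].
Proof.
move=> [crT hT] ab.
have cb : closed [set b] by exact/accessible_closed_set1/hausdorff_accessible.
have /uniform_separatorP-/(_ R)[f [cf _ fa fb]] := crT a _ cb ab.
by exists f; split=> //; [apply: fa; exists a|apply: fb; exists b].
Qed.

(** One step of the construction of disjoint bumps: from the infinite cozero
    set of h, split off a bump phi and keep an infinite cozero set, that of h',
    disjoint from it. Take f with values 0 and 1 at two points of the cozero set
    of h. The sets f < 2/3 and 1 - f < 2/3 cover it, so one of them meets it in an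
    infinite set, which is kept; the bump is placed at the one of the two points
    that lies outside. *)
Lemma cozero_step (R : realType) (T : topologicalType) (h : T -> R) :
  (forall a b : T, a <> b ->
    exists f : T -> R, [/\ continuous f, f a = 0 & f b = 1]) ->
  continuous h -> infinite_set [set x | h x != 0] ->
  exists (h' phi : T -> R) (p : T),
  [/\ continuous h', infinite_set [set x | h' x != 0],
      [/\ continuous phi, forall x, 0 <= phi x <= 1 & phi p = 1],
      forall x, h' x != 0 -> h x != 0 &
      forall x, phi x != 0 -> h x != 0 /\ h' x = 0].
Proof.
move=> sep ch ih.
(* The choice between f and 1 - f is symmetric; this is the case where f < 2/3
   is kept and the bump is at b. *)
suff half (f : T -> R) b : continuous f -> f b = 1 -> h b != 0 ->
    infinite_set ([set x | h x != 0] `&` [set x | f x < 2 / 3]) ->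
    exists (h' phi : T -> R) (p : T),
  [/\ continuous h', infinite_set [set x | h' x != 0],
      [/\ continuous phi, forall x, 0 <= phi x <= 1 & phi p = 1],
      forall x, h' x != 0 -> h x != 0 &
      forall x, phi x != 0 -> h x != 0 /\ h' x = 0].
  have [a ha] := infinite_setN0 ih.
  have [b [hb ba]] : exists b, h b != 0 /\ b <> a.
    apply: contrapT => nb; apply: ih; apply: sub_finite_set (finite_set1 a).
    by move=> x /= hx; apply: contrapT => xa; apply: nb; exists x.
  have [f [cf fb fa]] := sep b a ba.
  have cf' : continuous (fun x => 1 - f x : R).
    by move=> x; apply: cvgB; [exact: cvg_cst|exact: cf].
  have [fin|inf] := pselect (finite_set
      ([set x | h x != 0] `&` [set x | f x < 2 / 3])); last first.
    exact: (half f a).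
  apply: (half (fun x => 1 - f x) b) => //; first by rewrite fb subr0.
  move=> fin'; apply: ih; apply: sub_finite_set (_ : finite_set (_ `|` _)).
    2: by rewrite finite_setU; split; [exact: fin|exact: fin'].
  move=> x /= hx; have [fx|fx] := ltP (f x) (2 / 3); [by left|right].
  by split=> //; lra.
move=> cf fb hb inf.
(* The bump is the truncation at 1 of g, normalized to be 1 at b; the factor h
   keeps its cozero set inside that of h. *)
pose g x := `|h x| * Num.max 0 (f x - 2 / 3).
have gb0 : 0 < g b.
  by rewrite /g fb mulr_gt0 ?normr_gt0 // lt_max; apply/orP; right; lra.
have g0 x : 0 <= g x by rewrite /g mulr_ge0 // le_max lexx.
have cg : continuous g.
  move=> x; apply: cvgM; first by apply: cvg_norm; exact: ch.
  apply: (@continuous_max _ _ (fun=> 0) (fun x => f x - 2 / 3)).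
    exact: cvg_cst.
  by apply: cvgB; [exact: cf|exact: cvg_cst].
exists (fun x => h x * Num.max 0 (2 / 3 - f x)), (fun x => Num.min 1 (g x / g b)), b.
split.
- move=> x; apply: cvgM; first exact: ch.
  apply: (@continuous_max _ _ (fun=> 0) (fun x => 2 / 3 - f x)).
    exact: cvg_cst.
  by apply: cvgB; [exact: cvg_cst|exact: cf].
- apply: sub_infinite_set inf => x [/= hx fx]; rewrite mulf_neq0 //.
  by rewrite gt_eqF // lt_max subr_gt0 fx orbT.
- split.
  + move=> x; apply: (@continuous_min _ _ (fun=> 1) (fun x => g x / g b)).
      exact: cvg_cst.
    by apply: cvgM; [exact: cg|exact: cvg_cst].
  + by move=> x; rewrite le_min ler01 divr_ge0 //= ge_min lexx.
  + by rewrite divff ?minxx // gt_eqF.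
- by move=> x; apply: contraNN => /eqP ->; rewrite mul0r.
- move=> x /eqP phi0; have gx : g x != 0.
    apply/eqP => gx; apply: phi0; rewrite gx mul0r.
    by apply/min_idPr; exact: ler01.
  split; first by move: gx; apply: contraNN => /eqP hx; rewrite /g hx normr0 mul0r.
  have [fx|fx] := leP (f x) (2 / 3).
    by move: gx; rewrite /g max_l ?mulr0 ?eqxx // subr_le0.
  by rewrite max_l ?mulr0 // subr_le0 ltW.
Qed.

(** Iterating [cozero_step] from the constant 1: the cozero sets of the
    remainders decrease, and the bump split off at stage i vanishes on all later
    remainders, hence on all later cozero sets. *)
Lemma disjoint_bumps (R : realType) (T : topologicalType) :
  tychonoff_space T -> infinite_set [set: T] ->
  exists (phi : nat -> T -> R) (p : nat -> T),
  [/\ forall k, continuous (phi k), forall k x, 0 <= phi k x <= 1,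
      forall k, phi k (p k) = 1 &
      forall i j x, phi i x != 0 -> phi j x != 0 -> i = j].
Proof.
move=> tT iT.
pose good (h : T -> R) := continuous h /\ infinite_set [set x | h x != 0].
have step (h : {h | good h}) : exists q : {h | good h} * (T -> R) * T,
    [/\ [/\ continuous q.1.2, forall x, 0 <= q.1.2 x <= 1 & q.1.2 q.2 = 1],
      forall x, sval q.1.1 x != 0 -> sval h x != 0 &
      forall x, q.1.2 x != 0 -> sval h x != 0 /\ sval q.1.1 x = 0].
  case: h => h [/= ch ih].
  have [a b|h' [phi [p [ch' ih' *]]]] := @cozero_step R T h _ ch ih.
    exact: tychonoff_separates.
  have gh' : good h' by [].
  by exists (exist _ h' gh', phi, p); split.
have [F HF] := choice step.
have h0 : good (fun=> 1).
  split=> [x|]; first exact: cvg_cst.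
  by apply: sub_infinite_set iT => x _ /=; exact: oner_neq0.
pose st k := iter k (fun h => (F h).1.1) (exist _ _ h0).
have dec k m x : sval (st (k + m)%N) x != 0 -> sval (st k) x != 0.
  elim: m => [|m IH]; first by rewrite addn0.
  by rewrite addnS => hx; apply: IH; case: (HF (st (k + m)%N)) => _ /(_ x hx).
have dis i j x : (i < j)%N -> (F (st i)).1.2 x != 0 ->
    (F (st j)).1.2 x != 0 -> False.
  move=> ij phii phij.
  have [_ _ /(_ x phij)[hj _]] := HF (st j).
  have [_ _ /(_ x phii)[_ /eqP]] := HF (st i); apply/negP.
  by apply: (dec i.+1 (j - i.+1)%N); rewrite subnKC.
exists (fun k => (F (st k)).1.2), (fun k => (F (st k)).2); split.
- by move=> k; case: (HF (st k)) => -[].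
- by move=> k; case: (HF (st k)) => -[].
- by move=> k; case: (HF (st k)) => -[].
- by move=> i j x pi pj; case: (ltngtP i j) => // ij; case: (dis _ _ x ij).
Qed.

(** * Gluing along a disjoint family *)

(** The value i0 is a default, taken at the points where the whole family
    vanishes. With k, the sum over i of phi i x *: b i becomes the single term
    phi (k x) x *: b (k x), which makes sense for an infinite index type. *)
Lemma disjoint_selector (I X : Type) (R : nmodType) (phi : I -> X -> R) (i0 : I) :
  (forall i j x, phi i x != 0 -> phi j x != 0 -> i = j) ->
  exists k : X -> I, forall x i, phi i x != 0 -> k x = i.
Proof.
move=> dphi.
have ex x : exists k, forall i, phi i x != 0 -> k = i.
  have [[i phii]|nphi] := pselect (exists i, phi i x != 0).
    by exists i => j; exact: dphi.
  by exists i0 => i phii; case: nphi; exists i.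
by have [k kE] := choice ex; exists k.
Qed.

(** Up to an error that is uniform near x0, the glued function is a finite sum of
    the continuous functions phi i x *: b i. The smallness hypothesis covers both
    a locally finite family phi (the terms outside L vanish near x0) and a
    sequence b that tends to 0. *)
Lemma glue_continuous (R : realType) (X : topologicalType) (E : normedModType R)
    (I : eqType) (phi : I -> X -> R) (k : X -> I) (b : I -> E) (x0 : X) :
  (forall i, continuous (phi i)) -> (forall x i, phi i x != 0 -> k x = i) ->
  (forall e : R, 0 < e -> exists L : seq I,
    \forall x \near x0, forall i, i \notin L -> `|phi i x *: b i| <= e) ->
  {for x0, continuous (fun x => phi (k x) x *: b (k x))}.
Proof.
move=> cphi kE small; apply/(cvgrPdist_le (FF := nbhs_filter x0)) => e e0.
have e30 : 0 < e / 3 by rewrite divr_gt0.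
have [L nearL] := small _ e30.
pose part x := \sum_(i <- undup L) phi i x *: b i.
have cpart : part x @[x --> x0] --> part x0.
  apply: cvg_big => [|i _]; first exact: add_continuous.
  by apply: cvgZ; [exact: cphi|exact: cvg_cst].
have close : \forall x \near x0, `|phi (k x) x *: b (k x) - part x| <= e / 3.
  apply: filterS nearL => x xL; have [kL|kL] := boolP (k x \in L).
    rewrite /part (bigD1_seq (k x)) ?undup_uniq ?mem_undup //= big1.
      by rewrite addr0 subrr normr0 ltW.
    move=> i ik; have [->|phii] := eqVneq (phi i x) 0; first by rewrite scale0r.
    by move: ik; rewrite (kE _ _ phii) eqxx.
  rewrite /part big1_seq ?subr0; first exact: xL.
  move=> i /= iL; have [->|phii] := eqVneq (phi i x) 0; first by rewrite scale0r.
  by move: kL; rewrite (kE _ _ phii) -mem_undup iL.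
have close0 := nbhs_singleton close.
move/(cvgrPdist_le (FF := nbhs_filter x0))/(_ _ e30): cpart.
apply: filterS2 close => x closex partx.
rewrite (_ : _ - _ = (phi (k x0) x0 *: b (k x0) - part x0) +
  (part x0 - part x) - (phi (k x) x *: b (k x) - part x)); last first.
  by rewrite addrA subrK opprB addrA subrK.
rewrite (_ : e = e / 3 + e / 3 + e / 3); last by lra.
by rewrite (le_trans (ler_normB _ _)) // lerD // (le_trans (ler_normD _ _)) // lerD.
Qed.

(** The map a |-> (x |-> phi (k x) x *: (a_(N (k x)) *: u (k x))) as the
    embedding of a complemented copy. At a fixed x it depends on a single
    coordinate of a, so it is continuous as soon as the coordinates are; the map
    N allows a whole block of indices i to carry the same coordinate. *)
Lemma complemented_copy_glue (R : realType) (X : topologicalType)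
    (E : normedModType R) (F : tvsType R) (coord : F -> nat -> R)
    (I : eqType) (phi : I -> X -> R) (k : X -> I) (N : I -> nat) (u : I -> E)
    (S : Cp X E -> F) :
  (forall n a x y, coord (a *: x + y) n = a * coord x n + coord y n) ->
  (forall n, continuous (coord^~ n)) ->
  (forall i, continuous (phi i)) -> (forall x i, phi i x != 0 -> k x = i) ->
  (forall (a : F) (x0 : X) (e : R), 0 < e -> exists L : seq I,
    \forall x \near x0, forall i, i \notin L ->
      `|phi i x *: (coord a (N i) *: u i)| <= e) ->
  linear S -> continuous S ->
  (forall (f : Cp X E) (a : F),
    (forall x, (f : continuousType X E) x =
       phi (k x) x *: (coord a (N (k x)) *: u (k x))) -> S f = a) ->
  contains_complemented_copy (Cp X E) F.
Proof.
move=> clin cc cphi kE small lS cS SE.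
have cT (a : F) :
    continuous (fun x => phi (k x) x *: (coord a (N (k x)) *: u (k x))).
  move=> x0.
  exact: (@glue_continuous _ _ _ _ _ _ (fun i => coord a (N i) *: u i) _ cphi
    kE (small a x0)).
pose T (a : F) : Cp X E := (mkcts (cT a) : continuousType X E).
apply: (@complemented_copy_retract _ _ _ T S) => //.
- exact/Cp_hausdorff/norm_hausdorff.
- move=> a x y; apply/continuousEP => z /=.
  by rewrite /mkcts clin scalerDl scalerDr -scalerA scalerA mulrC -scalerA.
- apply: continuous_to_Cp => x a.
  apply: cvgZ; first exact: cvg_cst.
  by apply: cvgZ; [exact: cc|exact: cvg_cst].
- by move=> a; exact: SE.
Qed.

(** * A copy of the space of all sequences *)

Lemma sequence_avoiding (T : eqType) (r : T -> T -> Prop) :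
  (forall L : seq T, exists x, forall z, z \in L -> r x z) ->
  exists p : nat -> T, forall i j, (i < j)%N -> r (p j) (p i).
Proof.
move=> ex; have [F HF] := choice ex.
pose st k := iter k (fun L => F L :: L) [::].
exists (fun k => F (st k)) => i j; elim: j => // j IH.
suff mem m : (i < m)%N -> F (st i) \in st m by move=> ij; apply: HF; exact: mem.
elim: m => // m IHm; rewrite ltnS leq_eqVlt /= inE => /orP[/eqP ->|/IHm ->].
  by rewrite eqxx.
by rewrite orbT.
Qed.

(** The bumps are pulled back by f from the balls of radius e / 4 around the
    points f (p i) in E. Two of these balls whose centers are e apart cannot both
    meet a ball of radius e / 4, so the family is locally finite on X. *)
Lemma Romega_complemented (R : realType) (X : topologicalType)
    (E : normedModType R) (u : E) (l : E -> R) (f : X -> E) (e : R) :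
  linear (l : E -> R^o) -> continuous l -> l u = 1 -> continuous f -> 0 < e ->
  (forall L : seq X, exists x, forall z, z \in L -> e <= `|f x - f z|) ->
  contains_complemented_copy (Cp X E) (Romega R).
Proof.
move=> llin lc lu cf e0 /sequence_avoiding[p psep].
have inj i j : `|f (p i) - f (p j)| < e -> i = j.
  move=> pij; case: (ltngtP i j) => // /psep; last by rewrite leNgt pij.
  by rewrite distrC leNgt pij.
pose phi i x := Num.max 0 (1 - 4 / e * `|f x - f (p i)|).
have phi_neq0 i x : phi i x != 0 -> `|f x - f (p i)| < e / 4.
  apply: contraNT; rewrite -leNgt => le4; apply/eqP/max_l.
  by rewrite subr_le0 mulrC -ler_pdivrMr ?divr_gt0 // invf_div mul1r.
have phi_p i : phi i (p i) = 1 by rewrite /phi subrr normr0 mulr0 subr0 max_r.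
have cphi i : continuous (phi i).
  move=> x.
  apply: (@continuous_max _ _ (fun=> 0) (fun x => 1 - 4 / e * `|f x - f (p i)|)).
    exact: cvg_cst.
  apply: cvgB; first exact: cvg_cst.
  apply: cvgM; first exact: cvg_cst.
  by apply: cvg_norm; apply: cvgB; [exact: cf|exact: cvg_cst].
have near_inj i j x y : `|f x - f y| < e / 2 -> phi i x != 0 -> phi j y != 0 ->
    i = j.
  move=> xy /phi_neq0 xi /phi_neq0 yj; apply: inj.
  rewrite (_ : _ - _ = - (f x - f (p i)) + (f x - f y) + (f y - f (p j))).
    have -> : e = e / 4 + e / 2 + e / 4 by lra.
    rewrite (le_lt_trans (ler_normD _ _)) // ltrD //.
    by rewrite (le_lt_trans (ler_normD _ _)) // ltrD // normrN.
  by rewrite opprB !addrA !subrK.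
have [k kE] : exists k : X -> nat, forall x i, phi i x != 0 -> k x = i.
  apply: (disjoint_selector 0%N) => i j x; apply: near_inj.
  by rewrite subrr normr0 divr_gt0.
pose S (g : Cp X E) : Romega R := fun n => l ((g : continuousType X E) (p n)).
apply: (@complemented_copy_glue R X E (Romega R) (fun a => a) nat phi k id
  (fun=> u) S) => //.
- exact: Romega_coord_continuous.
- move=> a x0 d d0.
  have near4 : \forall x \near x0, `|f x0 - f x| < e / 4.
    have := cf x0; move/(cvgrPdist_lt (FF := nbhs_filter x0)); apply.
    by rewrite divr_gt0.
  have [[[x i] [/= xx0 phix]]|none] := pselect (exists q : X * nat,
      `|f x0 - f q.1| < e / 4 /\ phi q.2 q.1 != 0).
    exists [:: i]; apply: filterS near4 => y yx0 j; rewrite inE => ji.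
    have [->|phiy] := eqVneq (phi j y) 0; first by rewrite scale0r normr0 ltW.
    case/eqP: ji; apply: (near_inj _ _ y x) => //.
    rewrite -(subrK (f x0) (f y)) -addrA; have -> : e / 2 = e / 4 + e / 4 by lra.
    by rewrite (le_lt_trans (ler_normD _ _)) // ltrD // distrC.
  exists [::]; apply: filterS near4 => y yx0 j _.
  have [->|phiy] := eqVneq (phi j y) 0; first by rewrite scale0r normr0 ltW.
  by case: none; exists (y, j).
- by move=> a g h; apply/funext => n; exact: llin.
- apply: continuous_to_Romega => n.
  move=> g; apply: (@continuous_comp _ _ _
    (fun g : Cp X E => (g : continuousType X E) (p n)) l).
    exact: Cp_eval_continuous.
  exact: lc.
- move=> g a gE; apply/funext => n.
  have kp : k (p n) = n by apply: kE; rewrite phi_p oner_neq0.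
  rewrite /S gE kp phi_p scale1r.
  have l0 : l 0 = 0 by have := llin (-1) 0 0; rewrite scaler0 addr0 scaleN1r addNr.
  by have := llin (a n) u 0; rewrite addr0 l0 addr0 lu => ->; exact: mulr1.
Qed.

(** * Means of sign sums *)

(** Signs are coded by booleans, true standing for -1. *)
Definition sign_sum (R : realType) (n : nat) (s : seq bool) (c : nat -> R) : R :=
  \sum_(i < n) (-1) ^+ nth false s i * c i.

Lemma sum_tupleS (R : nmodType) (n : nat) (G : n.+1.-tuple bool -> R) :
  \sum_t G t = \sum_(t : n.-tuple bool) \sum_(b : bool) G (cons_tuple b t).
Proof.
rewrite pair_big /= (reindex (fun q : n.-tuple bool * bool => cons_tuple q.2 q.1)) //.
exists (fun t => (behead_tuple t, thead t)) => [[t b] _|t _] /=.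
  by congr pair; apply: val_inj.
by rewrite [RHS](tuple_eta t); apply: val_inj.
Qed.

(** Orthogonality of the Rademacher functions, in the form of an induction: the
    mixed terms cancel when the sum over the first sign is taken. *)
Lemma sum_sign_sum_sqr (R : realType) (n : nat) (c : nat -> R) :
  \sum_(s : n.-tuple bool) sign_sum n s c ^+ 2 =
  2 ^+ n * \sum_(i < n) c i ^+ 2.
Proof.
elim: n c => [|n IH] c.
  rewrite big_ord0 mulr0 big1 // => s _.
  by rewrite /sign_sum big_ord0 expr0n.
have head (b : bool) (s : seq bool) :
    sign_sum n.+1 (b :: s) c = (-1) ^+ b * c 0%N + sign_sum n s (c \o succn).
  by rewrite /sign_sum big_ord_recl.
rewrite sum_tupleS big_ord_recl /= mulrDr [in RHS]exprS -[X in _ + X]mulrA.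
rewrite -(IH (c \o succn)).
transitivity (\sum_(s : n.-tuple bool)
    (2 * c 0%N ^+ 2 + 2 * sign_sum n s (c \o succn) ^+ 2)).
  by apply: eq_bigr => s _; rewrite big_bool !head /= expr0 expr1; ring.
rewrite big_split /= sumr_const card_tuple card_bool -mulr_sumr.
by rewrite -[_ *+ (2 ^ n)]mulr_natr natrX; ring.
Qed.

(** The shift from n to n.+1 avoids a division by 0 in the first term; it is
    the same in [sign_mean] below. *)
Definition mean_sign_sum (R : realType) (n : nat) (c : nat -> R) : R :=
  (n.+1%:R * 2 ^+ n.+1)^-1 *
  \sum_(s : n.+1.-tuple bool) `|sign_sum n.+1 s c|.

(** A form of Khinchin's inequality. By the arithmetic-geometric mean
    inequality, |z| <= d m / 2 + z^2 / (2 d m) with m = n.+1, and the second moment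
    of the sign sum is at most m M^2. The parameter d replaces the square root
    that the Cauchy-Schwarz inequality would give. *)
Lemma mean_sign_sum_le (R : realType) (n : nat) (c : nat -> R) (M d : R) :
  0 < d -> (forall i, `|c i| <= M) ->
  mean_sign_sum n c <= d / 2 + M ^+ 2 / (2 * d * n.+1%:R).
Proof.
move=> d0 cM; rewrite /mean_sign_sum; set m := n.+1.
have m0 : 0 < m%:R :> R by rewrite ltr0n.
have p0 : 0 < 2 ^+ m :> R by rewrite exprn_gt0.
have amgm (z : R) : `|z| <= d * m%:R / 2 + z ^+ 2 / (2 * d * m%:R).
  have dm : 0 < d * m%:R by rewrite mulr_gt0.
  rewrite -subr_ge0 -[z ^+ 2]real_normK ?num_real //.
  rewrite (_ : _ - _ = (d * m%:R - `|z|) ^+ 2 / (2 * (d * m%:R))).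
    by rewrite divr_ge0 ?sqr_ge0 // mulr_ge0 // ltW.
  by field; rewrite !gt_eqF.
rewrite ler_pdivrMl ?mulr_gt0 //.
apply: (@le_trans _ _ (\sum_(s : m.-tuple bool)
    (d * m%:R / 2 + sign_sum m s c ^+ 2 / (2 * d * m%:R)))).
  by apply: ler_sum => s _; exact: amgm.
rewrite big_split /= sumr_const card_tuple card_bool -mulr_suml sum_sign_sum_sqr.
have sqr : \sum_(i < m) c i ^+ 2 <= m%:R * M ^+ 2.
  rewrite mulr_natl -[X in _ <= _ *+ X](card_ord m) -sumr_const.
  apply: ler_sum => i _.
  by rewrite -[c i ^+ 2]real_normK ?num_real // lerXn2r ?nnegrE // (le_trans _ (cM i)).
rewrite -[_ *+ (2 ^ m)]mulr_natr natrX mulrDr.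
apply: lerD; first by rewrite le_eqVlt; apply/orP; left; apply/eqP; ring.
rewrite [leRHS](_ : _ = 2 ^+ m * (m%:R * M ^+ 2) / (2 * d * m%:R)); last by ring.
by rewrite ler_pM2r ?invr_gt0 ?mulr_gt0 // ler_pM2l.
Qed.

Lemma mean_sign_sum_cvg0 (R : realType) (c : nat -> R) (M : R) :
  (forall i, `|c i| <= M) -> mean_sign_sum n c @[n --> \oo] --> (0 : R).
Proof.
move=> cM; apply/cvgrPdist_le => e e0.
near=> n.
rewrite sub0r normrN ger0_norm; last first.
  by rewrite mulr_ge0 ?invr_ge0 ?mulr_ge0 ?ler0n ?exprn_ge0 // sumr_ge0.
apply: (le_trans (mean_sign_sum_le n e0 cM)).
rewrite -lerBrDl (_ : e - e / 2 = e / 2); last by lra.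
rewrite ler_pdivrMr ?mulr_gt0 ?ltr0n //.
rewrite (_ : e / 2 * _ = e ^+ 2 * n.+1%:R); last by field.
rewrite mulrC -ler_pdivrMr ?exprn_gt0 //.
apply: (@le_trans _ _ n%:R); last by rewrite ler_nat.
near: n; exact: nbhs_infty_ger.
Unshelve. all: by end_near. Qed.

(** * Functionals on functions with totally bounded range *)

Lemma sign_sumP (R : realType) (n : nat) (s : seq bool) (a : R)
    (c d : nat -> R) :
  sign_sum n s (fun i => a * c i + d i) = a * sign_sum n s c + sign_sum n s d.
Proof.
rewrite /sign_sum mulr_sumr -big_split /=; apply: eq_bigr => i _.
by rewrite mulrDr mulrCA.
Qed.

Lemma sign_sum_le (R : realType) (n : nat) (s : seq bool) (c : nat -> R) (M : R) :
  (forall i, `|c i| <= M) -> `|sign_sum n s c| <= n%:R * M.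
Proof.
move=> cM; apply: (le_trans (ler_norm_sum _ _ _)).
rewrite mulr_natl -[X in _ <= _ *+ X](card_ord n) -sumr_const.
by apply: ler_sum => i _; rewrite normrM normrX normrN1 expr1n mul1r.
Qed.

(** The value at f of a combination of Dirac measures at the points (x s, y i)
    of X * Y, of total variation at most 1. *)
Definition sign_mean (R : realType) (X : Type) (Y : topologicalType)
    (x : seq bool -> X) (y : nat -> Y) (f : X -> continuousType Y R) (n : nat) : R :=
  (n.+1%:R * 2 ^+ n.+1)^-1 *
  \sum_(s : n.+1.-tuple bool) sign_sum n.+1 s (fun i => f (x s) (y i)).

(** For each s, replace f (x s) by an element of a finite net at distance less
    than e / 2; this element depends on s, so its sign sum is bounded by the sum
    over the whole net of the absolute values of the sign sums, and the mean over
    s of each of them tends to 0. *)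
Lemma sign_mean_cvg0 (R : realType) (X : eqType) (Y : topologicalType)
    (cY : compact [set: Y]) (x : seq bool -> X) (y : nat -> Y)
    (f : X -> Csup R cY) :
  (forall e : R, 0 < e -> exists L : seq X, forall x, exists2 z, z \in L &
    `|f x - f z| < e) ->
  sign_mean x y f n @[n --> \oo] --> (0 : R).
Proof.
move=> net; apply/cvgrPdist_le => e e0.
have e20 : 0 < e / 2 by rewrite divr_gt0.
have [L netL] := net _ e20.
pose g (z : X) (i : nat) : R := (f z : continuousType Y R) (y i).
have sum0 : \sum_(z <- L) mean_sign_sum n (g z) @[n --> \oo] --> (0 : R).
  rewrite -[X in _ --> X](_ : \sum_(z <- L) (0 : R) = 0); last by rewrite big1.
  apply: cvg_big => [|z _]; first exact: add_continuous.
  by apply: (@mean_sign_sum_cvg0 _ _ `|f z|) => i; exact: (le_sup_norm cY).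
move/cvgrPdist_le/(_ _ e20): sum0; apply: filterS => n.
have M0 k : 0 <= (k.+1%:R * 2 ^+ k.+1)^-1 :> R.
  by rewrite invr_ge0 mulr_ge0 ?ler0n ?exprn_ge0.
rewrite !sub0r !normrN => sum_le; apply: (@le_trans _ _ (e / 2 +
    \sum_(z <- L) mean_sign_sum n (g z))); last first.
  rewrite [leRHS](_ : e = e / 2 + e / 2); last by lra.
  by rewrite lerD2l; apply: le_trans sum_le; exact: ler_norm.
rewrite /sign_mean normrM ger0_norm //; set m := n.+1.
have m0 : 0 < m%:R * 2 ^+ m :> R by rewrite mulr_gt0 ?ltr0n ?exprn_gt0.
rewrite ler_pdivrMl // mulrDr mulr_sumr.
apply: (@le_trans _ _ (\sum_(s : m.-tuple bool)
    (m%:R * (e / 2) + \sum_(z <- L) `|sign_sum m s (g z)|))); last first.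
  rewrite big_split /= sumr_const card_tuple card_bool.
  rewrite -[_ *+ (2 ^ m)]mulr_natr natrX.
  rewrite [leRHS]addrC [leLHS]addrC lerD //; last first.
    by rewrite le_eqVlt; apply/orP; left; apply/eqP; ring.
  rewrite exchange_big /=; apply: ler_sum => z _.
  by rewrite /mean_sign_sum mulVKf // gt_eqF.
apply: (le_trans (ler_norm_sum _ _ _)); apply: ler_sum => s _.
have [z zL fz] := netL (x s).
have -> : sign_sum m s (fun i => (f (x s) : continuousType Y R) (y i)) =
    sign_sum m s (fun i => ((f (x s) - f z : Csup R cY) : continuousType Y R) (y i))
    + sign_sum m s (g z).
  rewrite -[X in _ = X + _]mul1r -sign_sumP; congr sign_sum; apply/funext => i.
  by rewrite mul1r /g; exact: esym (subrK _ _).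
apply: (le_trans (ler_normD _ _)); apply: lerD.
  apply: sign_sum_le => i; apply: le_trans (ltW fz).
  exact: (le_sup_norm cY (f (x s) - f z : Csup R cY)).
rewrite (big_rem z) //= lerDl; apply: sumr_ge0 => *; exact: normr_ge0.
Qed.

(** * A copy of the space of null sequences *)

Lemma sign_mean_linear (R : realType) (X Y : topologicalType)
    (cY : compact [set: Y]) (x : seq bool -> X) (y : nat -> Y) (n : nat) (a : R)
    (f g : Cp X (Csup R cY)) :
  sign_mean x y (a *: f + g : continuousType X (Csup R cY)) n =
  a * sign_mean x y (f : continuousType X (Csup R cY)) n +
  sign_mean x y (g : continuousType X (Csup R cY)) n.
Proof.
rewrite /sign_mean mulrCA -mulrDr; congr (_ * _).
by rewrite mulr_sumr -big_split /=; apply: eq_bigr => s _; rewrite -sign_sumP.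
Qed.

Lemma sign_mean_continuous (R : realType) (X : Type) (T Y : topologicalType)
    (x : seq bool -> X) (y : nat -> Y) (n : nat)
    (G : T -> X -> continuousType Y R) :
  (forall s i, continuous (fun t => G t (x s) (y i))) ->
  continuous (fun t => sign_mean x y (G t) n).
Proof.
rewrite /sign_mean => cG t; apply: cvgM; first exact: cvg_cst.
apply: cvg_big => [|s _]; first exact: add_continuous.
apply: cvg_big => [|i _]; first exact: add_continuous.
by apply: cvgM; [exact: cvg_cst|exact: cG].
Qed.

(** The coordinate n of a sequence is carried by the bumps phi_s for all s of
    length n.+1, and u s = sum_i s_i psi_i, so that s_i (u s)(q i) = 1 for all
    i < n.+1: the signs cancel and the functional [sign_mean] recovers the
    coordinate. *)
Lemma c0p_complemented (R : realType) (X Y : topologicalType)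
    (cY : compact [set: Y]) (phi : nat -> X -> R) (p : nat -> X)
    (psi : nat -> Y -> R) (q : nat -> Y) :
  [/\ forall k, continuous (phi k), forall k x, 0 <= phi k x <= 1,
      forall k, phi k (p k) = 1 &
      forall i j x, phi i x != 0 -> phi j x != 0 -> i = j] ->
  [/\ forall k, continuous (psi k), forall k y, 0 <= psi k y <= 1,
      forall k, psi k (q k) = 1 &
      forall i j y, psi i y != 0 -> psi j y != 0 -> i = j] ->
  (forall (f : continuousType X (Csup R cY)) (e : R), 0 < e ->
    exists L : seq X, forall x, exists2 z, z \in L & `|f x - f z| < e) ->
  contains_complemented_copy (Cp X (Csup R cY)) (c0p R).
Proof.
move=> [cphi phi01 phi_p dphi] [cpsi psi01 psi_q dpsi] net.
have psi_qE i j : psi i (q j) = (i == j)%:R.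
  have [->|ij] := eqVneq i j; first exact: psi_q.
  apply/eqP; apply: contraNT ij => psii; apply/eqP/(dpsi _ _ (q j)) => //.
  by rewrite psi_q oner_neq0.
have cu (s : seq bool) :
    continuous (fun y => sign_sum (size s) s (fun i => psi i y)).
  move=> y; apply: cvg_big => [|i _]; first exact: add_continuous.
  by apply: cvgM; [exact: cvg_cst|exact: cpsi].
pose u s : Csup R cY := (mkcts (cu s) : continuousType Y R).
have u_le1 s : `|u s| <= 1.
  apply: (sup_norm_le (f := u s)) => // y.
  change (`|\sum_(i < size s) (-1) ^+ nth false s i * psi i y| <= 1).
  have [[j psij]|none] := pselect (exists j : 'I_(size s), psi j y != 0).
    rewrite (bigD1 j) //= big1 ?addr0 => [|i ij].
      rewrite normrM normrX normrN1 expr1n mul1r ger0_norm.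
        by case/andP: (psi01 j y).
      by case/andP: (psi01 j y).
    have [->|psii] := eqVneq (psi i y) 0; first by rewrite mulr0.
    by case/eqP: ij; apply: val_inj; exact: (dpsi _ _ y).
  rewrite big1 ?normr0 // => i _.
  have [->|psii] := eqVneq (psi i y) 0; first by rewrite mulr0.
  by case: none; exists i.
have u_q s i : (i < size s)%N ->
    (u s : continuousType Y R) (q i) = (-1) ^+ nth false s i.
  move=> si; change (\sum_(j < size s) (-1) ^+ nth false s j * psi j (q i) =
    (-1) ^+ nth false s i).
  rewrite (bigD1 (Ordinal si)) //= big1 ?addr0 => [|j ji].
    by rewrite psi_q mulr1.
  by rewrite psi_qE (_ : (_ == _) = false) ?mulr0 //; exact: negbTE.
(* The bumps on X are renumbered by sequences of signs, which are countable. *)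
pose phis s := phi (pickle (s : seq bool)).
pose xs s := p (pickle (s : seq bool)).
have phis_x s : phis s (xs s) = 1 by exact: phi_p.
have [k kE] : exists k : X -> seq bool, forall x s, phis s x != 0 -> k x = s.
  apply: (disjoint_selector [::]) => s t x phisx phitx.
  by apply: (pcan_inj pickleK); exact: (dphi _ _ x).
have Sc0 (f : Cp X (Csup R cY)) :
    (sign_mean xs q (f : continuousType X (Csup R cY)) : Romega R) \in @c0 R.
  by rewrite unfold_in; apply/asboolP/(sign_mean_cvg0 (cY := cY)) => e; exact: net.
pose S f : c0p R := C0p (Sc0 f).
apply: (@complemented_copy_glue R X (Csup R cY) (c0p R)
  (fun a => c0p_val a : nat -> R) (seq bool) phis k (fun s => (size s).-1) u S).
- by [].
- exact: c0p_coord_continuous.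
- by move=> s; exact: cphi.
- exact: kE.
- move=> [a /=]; rewrite unfold_in => /asboolP a0 x0 e e0.
  move/cvgrPdist_le/(_ _ e0): a0 => [K _ aK].
  (* L consists of all the sequences of length at most K. *)
  exists (flatten [seq [seq val t | t <- enum {: n.-tuple bool}] |
                   n <- iota 0 K.+1]).
  apply: (@filterS _ _ (nbhs_filter x0) setT); last exact: filterT.
  move=> x _ s sL.
  have Ks : (K < size s)%N.
    rewrite ltnNge; apply: contra sL => sK; apply/flatten_mapP.
    exists (size s); first by rewrite mem_iota.
    by apply/mapP; exists (in_tuple s); rewrite ?mem_enum.
  have := aK (size s).-1; rewrite /= sub0r normrN => /(_ _)/wrap[].
    by rewrite -ltnS prednK // (leq_ltn_trans _ Ks).
  apply: le_trans; rewrite !normrZ mulrCA ler_piMr // mulr_ile1 //.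
  by case/andP: (phi01 (pickle s) x) => ? ?; rewrite ger0_norm.
- move=> c f g; apply: val_inj; apply/funext => n.
  exact: sign_mean_linear.
- apply: continuous_to_c0p => n; apply: sign_mean_continuous => s i f.
  apply: (@continuous_comp _ _ _
    (fun f : Cp X (Csup R cY) => (f : continuousType X (Csup R cY)) (xs s))
    (fun g : Csup R cY => (g : continuousType Y R) (q i))).
    exact: Cp_eval_continuous.
  exact: Csup_eval_continuous.
move=> f a fE; apply: val_inj; apply/funext => n /=.
rewrite /sign_mean; apply: (canLR (mulKf _)).
  by rewrite mulf_neq0 // ?pnatr_eq0 // expf_neq0 // pnatr_eq0.
transitivity (\sum_(s : n.+1.-tuple bool) (n.+1%:R * (c0p_val a : nat -> R) n)).
  apply: eq_bigr => s _.
  rewrite mulr_natl -[X in _ = _ *+ X](card_ord n.+1) -sumr_const.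
  apply: eq_bigr => i _; rewrite fE.
  have -> : k (xs s) = s by apply: kE; rewrite phis_x oner_neq0.
  rewrite phis_x scale1r size_tuple continuousZE u_q ?size_tuple //.
  by rewrite mulrCA -expr2 sqrr_sign mulr1.
rewrite sumr_const card_tuple card_bool -[_ *+ (2 ^ _)]mulr_natr natrX.
by rewrite mulrAC.
Qed.

(** * The dichotomy *)

Theorem corollary6p6 (R : realType) (X Y : topologicalType)
  (tychX : tychonoff_space X) (infX : infinite_set [set: X])
  (tychY : tychonoff_space Y) (infY : infinite_set [set: Y])
  (cptY : compact [set: Y]) :
  contains_complemented_copy (Cp X (Csup R cptY)) (Romega R) \/
  contains_complemented_copy (Cp X (Csup R cptY)) (c0p R).
Proof.
have [[f [e [e0 fL]]]|bounded] := pselect (exists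
    (f : continuousType X (Csup R cptY)) (e : R), 0 < e /\
    forall L : seq X, exists x, forall z, z \in L -> e <= `|f x - f z|).
  left; have [y0 _] := infinite_setN0 infY.
  have cst1 : continuous (fun _ : Y => 1 : R) by move=> y; exact: cvg_cst.
  pose u : Csup R cptY := (mkcts cst1 : continuousType Y R).
  apply: (@Romega_complemented R X _ u
    (fun g => (g : continuousType Y R) y0) f e) => //.
    exact: Csup_eval_continuous.
  exact: cts_fun.
right.
have [phi [p phiP]] := @disjoint_bumps R X tychX infX.
have [psi [q psiP]] := @disjoint_bumps R Y tychY infY.
apply: (c0p_complemented phiP psiP) => f e e0; apply: contrapT => nonet.
apply: bounded; exists f, e; split=> // L; apply: contrapT => nox.
apply: nonet; exists L => x; apply: contrapT => noz.
apply: nox; exists x => z zL; rewrite leNgt; apply/negP => fz.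
by apply: noz; exists z.
Qed.
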